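(* Let $m\in\mathbb N$ and suppose $A_1,\dots,A_m\subset\mathbb N_0$ form an $m$-part sum system. Then for each $j\in\{1,\dots,m\}$, $A_j=(\max A_j)-A_j$, i.e. $x\in A_j$ if and only if $\max A_j-x\in A_j$. Moreover, if all component sets $A_j$ have odd cardinality, then $\max A_j$ is even for every $j$; if at least one component set has even cardinality, then $\max A_j$ is odd for exactly one $j\in\{1,\dots,m\}$.
   Context: $\mathbb N=\{1,2,\dots\}$, $\mathbb N_0=\mathbb N\cup\{0\}$, $\langle N\rangle=\{0,1,\dots,N-1\}$; $A+B=\{x+y:x\in A,y\in B\}$, $c-A=\{c-x:x\in A\}$. An $m$-part sum system is a collection of finite sets $A_1,\dots,A_m\subset\mathbb N_0$, each of cardinality at least 2, with $\sum_{k=1}^mA_k=\langle\prod_{k=1}^m|A_k|\rangle$. *)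

(* Defs.v *)
From HB Require Import structures.
From mathcomp Require Import all_boot all_order finmap.

Set Implicit Arguments.
Unset Strict Implicit.
Unset Printing Implicit Defensive.

Local Open Scope fset_scope.
Local Open Scope nat_scope.

Definition interval0 (N : nat) : {fset nat} := [fset x in iota 0 N].

Definition sumset (A B : {fset nat}) : {fset nat} :=
  [fset x + y | x in A, y in B].

(* [fset 0] is the neutral element of sumset. *)
Definition big_sumset (m : nat) (A : 'I_m -> {fset nat}) : {fset nat} :=
  \big[sumset/[fset 0]]_(k < m) A k.

Definition sum_system (m : nat) (A : 'I_m -> {fset nat}) : Prop :=
  (forall k : 'I_m, 2 <= #|` A k|) /\
  big_sumset A = interval0 (\prod_(k < m) #|` A k|).

(* Equal to 0 on the empty set. *)
Definition fset_max (A : {fset nat}) : nat := \max_(x <- A) x.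

(* c - A; the subtraction is truncated, so this is the usual set only when
   every element of A is at most c, as is the case for c = fset_max A. *)
Definition csub (c : nat) (A : {fset nat}) : {fset nat} :=
  [fset c - x | x in A].

(* Main.v *)
Require Import Defs.
From HB Require Import structures.
From mathcomp Require Import all_boot all_order finmap.
From mathcomp Require Import all_algebra all_field.

Import Order.TTheory GRing.Theory Num.Theory.

Local Open Scope fset_scope.
Local Open Scope nat_scope.

(** Encode a set [A] by the polynomial [\sum_(x in A) 'X^x]. For a sum system
    the product of these polynomials is [1 + 'X + ... + 'X^(N-1)], a divisor of
    the separable polynomial ['X^N - 1]. Hence the roots of each factor are
    simple, lie on the unit circle and, the coefficients being real, are stable
    under [z |-> z^* = z^-1]; so each factor equals its reciprocal polynomial,
    which is the polynomial of [max A - A]. If [max A] is odd, this symmetry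
    forces [-1] to be a root, and [-1] is a simple root of the product if [N]
    is even, and not a root if [N] is odd. Finally the maxima add up to
    [N - 1]. *)

(** * Polynomials with 0/1 coefficients attached to finite sets *)

Definition fset_poly (A : {fset nat}) : {poly algC} := (\sum_(x <- A) 'X^x)%R.

Lemma coef_fset_poly (A : {fset nat}) (n : nat) :
  ((fset_poly A)`_n = (n \in A)%:R)%R.
Proof.
rewrite coef_sum; under eq_bigr => x _ do rewrite coefXn.
have [nA|nA] := boolP (n \in A).
  rewrite (big_fsetD1 n) //= eqxx big_seq big1 ?addr0 // => x.
  by rewrite !inE eq_sym => /andP[/negPf->].
rewrite big_seq big1 // => x xA.
by case: eqP => // nx; rewrite nx xA in nA.
Qed.

Lemma fset_poly_inj : injective fset_poly.
Proof.
move=> A B eqAB; apply/fsetP => n.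
have /eqP := congr1 (fun p : {poly algC} => p`_n)%R eqAB.
by rewrite !coef_fset_poly eqr_nat; do 2!case: (n \in _).
Qed.

Lemma horner_fset_poly (A : {fset nat}) (z : algC) :
  ((fset_poly A).[z] = \sum_(x <- A) z ^+ x)%R.
Proof. by rewrite horner_sum; apply: eq_bigr => x _; rewrite hornerXn. Qed.

Lemma horner_fset_poly1 (A : {fset nat}) : ((fset_poly A).[1] = #|` A|%:R)%R.
Proof.
rewrite horner_fset_poly; under eq_bigr => x _ do rewrite expr1n.
by rewrite big_const_seq count_predT iter_addr_0.
Qed.

Lemma horner_fset_poly_conj (A : {fset nat}) (z : algC) :
  ((fset_poly A).[z^*] = ((fset_poly A).[z])^*)%R.
Proof.
rewrite !horner_fset_poly rmorph_sum /=.
by apply: eq_bigr => x _; rewrite rmorphXn.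
Qed.

(** The bound makes [x |-> M - x] injective on [A], so the sum can be reindexed; the right-hand side
    is the reciprocal polynomial at [z]. *)
Lemma horner_csub (A : {fset nat}) (M : nat) (z : algC) :
    (forall x, x \in A -> x <= M) -> (z != 0)%R ->
  ((fset_poly (csub M A)).[z] = z ^+ M * (fset_poly A).[z^-1])%R.
Proof.
move=> AM z0; rewrite !horner_fset_poly big_imfset /=; last first.
  by move=> x y xA yA e; rewrite -(subKn (AM x xA)) e subKn ?AM.
rewrite mulr_sumr big_seq [RHS]big_seq; apply: eq_bigr => x xA.
by rewrite exprVn expfB_cond ?(negPf z0) ?AM.
Qed.

Lemma size_fset_poly (A : {fset nat}) (M : nat) :
  M \in A -> (forall x, x \in A -> x <= M) -> size (fset_poly A) = M.+1.
Proof.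
move=> MA AM; apply/eqP; rewrite eqn_leq; apply/andP; split.
  apply/leq_sizeP => j Mj; rewrite coef_fset_poly.
  by case: (boolP (j \in A)) => // /AM; rewrite leqNgt Mj.
rewrite ltnNge; apply/leq_sizeP => /(_ M (leqnn M))/eqP.
by rewrite coef_fset_poly MA oner_eq0.
Qed.

(** The leading coefficient is nonzero, and every coefficient is 0 or 1. *)
Lemma monic_fset_poly (A : {fset nat}) : A != fset0 -> fset_poly A \is monic.
Proof.
move=> /fset0Pn[x xA].
have pA0 : (fset_poly A != 0)%R.
  by apply: contraTneq xA => /(congr1 (fun p : {poly algC} => p`_x)%R) /eqP;
     rewrite coef_fset_poly coef0 pnatr_eq0 eqb0.
have := pA0; rewrite -lead_coef_eq0 monicE lead_coefE coef_fset_poly.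
by rewrite pnatr_eq0 eqb0 negbK => ->.
Qed.

Lemma leq_fset_max (A : {fset nat}) (x : nat) : x \in A -> x <= fset_max A.
Proof. by move=> xA; rewrite /fset_max leq_bigmax_seq. Qed.

Lemma fset_max_in (A : {fset nat}) : A != fset0 -> fset_max A \in A.
Proof.
move=> /fset0Pn[x xA]; have [M MA AM] : exists2 M, M \in A & fset_max A <= M.
  have [M MA AM] := @arg_maxnP _ [` xA] predT val isT.
  exists (val M); first exact: valP.
  by apply/bigmax_leqP_seq => y yA _; have := AM [` yA] isT.
by rewrite (@anti_leq (fset_max A) M) // AM leq_fset_max.
Qed.

(** * Products of set polynomials and sumsets *)

(** The coefficient counts the ways to write [n] as a sum of one element from each [A k], hence is
    at least 1 on the sumset. *)
Lemma coef_prod_fset_poly (m : nat) (A : 'I_m -> {fset nat}) (n : nat) :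
  ((n \in big_sumset A)%:R <= (\prod_(k < m) fset_poly (A k))`_n)%R.
Proof.
suff [] : (forall n, 0 <= (\prod_(k < m) fset_poly (A k))`_n)%R /\
   (forall n, n \in big_sumset A -> 1 <= (\prod_(k < m) fset_poly (A k))`_n)%R.
  by move=> p0 p1; case: (boolP (n \in _)) => [/p1|_].
rewrite /big_sumset {n}; pose K (S : {fset nat}) (p : {poly algC}) :=
  (forall n, 0 <= p`_n)%R /\ (forall n, n \in S -> 1 <= p`_n)%R.
apply: (big_rec2 K) => [|i S p _ [p0 p1]].
  split=> n; first by rewrite coef1 ler0n.
  by rewrite inE => /eqP->; rewrite coef1 eqxx.
have coefE n : ((fset_poly (A i) * p)`_n =
    \sum_(x <- A i) (if (n < x)%N then 0 else p`_(n - x)))%R.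
  by rewrite mulr_suml coef_sum; apply: eq_bigr => x _; rewrite coefXnM.
have ge0 n x : (0 <= (if (n < x)%N then 0 else p`_(n - x)) :> algC)%R.
  by case: ifP.
split=> n; rewrite coefE; first exact: sumr_ge0.
case/imfset2P => x /= xA [y /= yS ->].
rewrite (big_fsetD1 x) //= ltnNge leq_addr /= addKn -[1%R]addr0.
by rewrite lerD ?p1 // sumr_ge0.
Qed.

(* The difference of the two sides has nonnegative coefficients and vanishes
   at 1, by the cardinality condition. *)
Lemma prod_fset_poly (m : nat) (A : 'I_m -> {fset nat}) :
    #|` big_sumset A| = \prod_(k < m) #|` A k| ->
  (\prod_(k < m) fset_poly (A k) = fset_poly (big_sumset A))%R.
Proof.
move=> cardA; apply/eqP; rewrite -subr_eq0; set d := (_ - _)%R.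
have d_ge0 n : (0 <= d`_n)%R.
  by rewrite coefB coef_fset_poly subr_ge0 coef_prod_fset_poly.
have d1 : (d.[1] = 0)%R.
  rewrite !hornerE horner_prod horner_fset_poly1 cardA natr_prod.
  by rewrite (eq_bigr _ (fun k _ => horner_fset_poly1 (A k))) subrr.
move: d1; rewrite horner_coef; under eq_bigr => i _ do rewrite expr1n mulr1.
move/psumr_eq0P => d0; apply/eqP/polyP => n; rewrite coef0.
have [ns|ns] := ltnP n (size d); last by rewrite nth_default.
by apply: (d0 _ (Ordinal ns)) => // i _; apply: d_ge0.
Qed.

Lemma mem_interval0 (N n : nat) : (n \in interval0 N) = (n < N).
Proof. by rewrite !inE mem_iota. Qed.

Lemma card_interval0 (N : nat) : #|` interval0 N| = N.
Proof. by rewrite card_fseq undup_id ?iota_uniq // size_iota. Qed.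

Lemma fset_poly_interval0 (N : nat) :
  (fset_poly (interval0 N) = \sum_(i < N) 'X^i)%R.
Proof.
transitivity (\poly_(i < N) 1 : {poly algC})%R; last first.
  by rewrite poly_def; apply: eq_bigr => i _; rewrite scale1r.
apply/polyP => n; rewrite coef_fset_poly mem_interval0 coef_poly.
by case: (n < N).
Qed.

(** * Symmetry of a set whose polynomial divides ['X^N - 1] *)

Section DivisorOfUnityPolynomial.

Variables (N : nat) (A : {fset nat}).
Hypothesis N_gt0 : 0 < N.
Hypothesis dvdA : (fset_poly A %| 'X^N - 1)%R.

Lemma fset_poly_root_unity (z : algC) : root (fset_poly A) z -> (z ^+ N = 1)%R.
Proof.
move=> /(root_dvdp dvdA); rewrite rootE !hornerE subr_eq0.
by move/eqP.
Qed.

Lemma fset_poly_root_inv (z : algC) :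
  root (fset_poly A) z -> root (fset_poly A) z^-1%R.
Proof.
move=> pz0; have zN1 := fset_poly_root_unity z pz0.
have z1 : (`|z| = 1)%R.
  by apply/eqP; rewrite -(@pexpr_eq1 _ _ N) -?normrX ?zN1 ?normr1.
rewrite invC_norm z1 expr1n invr1 mul1r rootE horner_fset_poly_conj.
by rewrite (eqP pz0) rmorph0.
Qed.

(** Since [0 \in A], both polynomials are monic of degree [max A], so it suffices that one divides
    the other. The roots of [fset_poly A] being simple, this can be checked root by root. *)
Lemma fset_reflection : 0 \in A -> A = csub (fset_max A) A.
Proof.
move=> A0; set M := fset_max A.
have An0 : A != fset0 by apply/fset0Pn; exists 0.
have AM x : x \in A -> x <= M by apply: leq_fset_max.
have MB : M \in csub M A by apply/imfsetP; exists 0; rewrite ?subn0.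
have BM x : x \in csub M A -> x <= M by case/imfsetP => y _ ->; apply: leq_subr.
have Bn0 : csub M A != fset0 by apply/fset0Pn; exists M.
apply: fset_poly_inj; apply/eqP.
rewrite -eqp_monic ?monic_fset_poly // -dvdp_size_eqp; last first.
  have [r Ar] := closed_field_poly_normal (fset_poly A).
  rewrite (monicP (monic_fset_poly A An0)) scale1r in Ar.
  rewrite Ar; apply: uniq_roots_dvdp.
    apply/allP => z zr.
    have pz0 : root (fset_poly A) z by rewrite Ar root_prod_XsubC.
    have z0 : (z != 0)%R.
      apply: contra_eq_neq (fset_poly_root_unity z pz0) => ->.
      by rewrite expr0n gtn_eqF // eq_sym oner_neq0.
    by rewrite rootE horner_csub // (eqP (fset_poly_root_inv z pz0)) mulr0.
  (* Simplicity of the roots is inherited from ['X^N - 1], as [N] is nonzero in characteristic 0. *)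
  rewrite uniq_rootsE -separable_prod_XsubC -Ar.
  apply: dvdp_separable dvdA _; apply: separable_Xn_sub_1.
  by rewrite pnatr_eq0 -lt0n.
by rewrite (size_fset_poly A M) ?fset_max_in // (size_fset_poly _ M).
Qed.

(** At [-1], which is its own inverse, the reflection reads [P(-1) = (-1)^M P(-1) = - P(-1)]. *)
Lemma root_fset_poly_opp1 :
  0 \in A -> odd (fset_max A) -> root (fset_poly A) (-1)%R.
Proof.
move=> A0 oddM.
have := horner_csub A (fset_max A) (-1)%R (leq_fset_max A).
rewrite -fset_reflection // oppr_eq0 oner_eq0 invrN1 => /(_ isT).
rewrite -signr_odd oddM expr1 mulN1r => /eqP.
by rewrite -addr_eq0 -mulr2n mulrn_eq0 /= rootE.
Qed.

End DivisorOfUnityPolynomial.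

(** * Consequences for sum systems *)

Section SumSystem.

Variables (m : nat) (A : 'I_m -> {fset nat}).
Hypothesis hA : sum_system A.
Let N := \prod_(k < m) #|` A k|.

Lemma sum_system_prod :
  (\prod_(k < m) fset_poly (A k) = \sum_(i < N) 'X^i)%R.
Proof.
have [_ eqA] := hA.
by rewrite prod_fset_poly eqA ?card_interval0 // fset_poly_interval0.
Qed.

Lemma sum_system_gt0 : 0 < N.
Proof. by apply: prodn_gt0 => k; apply: leq_trans (hA.1 k). Qed.

Lemma sum_system_neq0 (k : 'I_m) : A k != fset0.
Proof. by rewrite -cardfs_gt0; apply: leq_trans (hA.1 k). Qed.

(** The constant coefficients multiply to 1, so none of them is 0. *)
Lemma sum_system_has0 (k : 'I_m) : 0 \in A k.
Proof.
have p0 : ((\prod_(k < m) fset_poly (A k)).[0] = 1)%R.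
  rewrite sum_system_prod -fset_poly_interval0 horner_coef0 coef_fset_poly.
  by rewrite mem_interval0 sum_system_gt0.
apply: contra_eqT p0; rewrite horner_prod (bigD1 k) //= horner_coef0.
by rewrite coef_fset_poly => /negPf->; rewrite mul0r eq_sym oner_eq0.
Qed.

Lemma sum_system_dvd : (\prod_(k < m) fset_poly (A k) %| 'X^N - 1)%R.
Proof. by rewrite sum_system_prod subrX1 dvdp_mulIr. Qed.

Lemma sum_system_dvd1 (k : 'I_m) : (fset_poly (A k) %| 'X^N - 1)%R.
Proof. by apply: dvdp_trans sum_system_dvd; rewrite (bigD1 k) //= dvdp_mulIl. Qed.

(** Compare degrees in [sum_system_prod]. *)
Lemma sum_system_max : (\sum_(k < m) fset_max (A k)).+1 = N.
Proof.
have pn0 k : (fset_poly (A k) != 0)%R.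
  by rewrite monic_neq0 // monic_fset_poly // sum_system_neq0.
have := congr1 (fun p : {poly algC} => size p) sum_system_prod.
rewrite size_prod // -fset_poly_interval0.
rewrite (eq_bigr (fun k => fset_max (A k) + 1)); last first.
  move=> k _; rewrite addn1; apply: size_fset_poly; last exact: leq_fset_max.
  exact/fset_max_in/sum_system_neq0.
(* Each size exceeds the degree by one; these [m] units cancel against the correction term of
   [size_prod]. *)
rewrite big_split /= sum1_card -addSn addnK => ->.
rewrite (size_fset_poly _ N.-1) ?prednK ?sum_system_gt0 //.
  by rewrite mem_interval0 prednK ?sum_system_gt0.
by move=> x; rewrite mem_interval0 => xN; rewrite -ltnS prednK ?sum_system_gt0.
Qed.

Lemma sum_system_root_opp1 (k : 'I_m) :
  odd (fset_max (A k)) -> root (fset_poly (A k)) (-1)%R.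
Proof.
exact/(root_fset_poly_opp1 N)/sum_system_has0/sum_system_dvd1/sum_system_gt0.
Qed.

(** Here [-1] is an [N]-th root of unity, which excludes odd [N]. *)
Lemma sum_system_odd_max (k : 'I_m) : odd (fset_max (A k)) -> ~~ odd N.
Proof.
move/sum_system_root_opp1 => /(root_dvdp (sum_system_dvd1 k)).
rewrite rootE !hornerE -signr_odd; case: (odd N) => //.
by rewrite expr1 -opprD oppr_eq0 -mulr2n pnatr_eq0.
Qed.

(** For [j != k] the product of the two polynomials divides a separable one, so they are coprime and
    cannot share the root [-1]. *)
Lemma sum_system_odd_max_inj (j k : 'I_m) :
  odd (fset_max (A j)) -> odd (fset_max (A k)) -> j = k.
Proof.
move=> oj ok; apply: contraTeq (sum_system_root_opp1 k ok) => neq_jk.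
have sepN : separable_poly ('X^N - 1 : {poly algC})%R.
  by apply: separable_Xn_sub_1; rewrite pnatr_eq0 -lt0n sum_system_gt0.
apply: coprimep_root (sum_system_root_opp1 j oj).
apply: separable_coprime sepN _; apply: dvdp_trans sum_system_dvd.
by rewrite (bigD1 j) //= (bigD1 k) 1?eq_sym //= mulrA dvdp_mulIl.
Qed.

End SumSystem.

Theorem theorem1 (m : nat) (hm : 0 < m) (A : 'I_m -> {fset nat})
    (hA : sum_system A) :
  (forall j : 'I_m,
     A j = csub (fset_max (A j)) (A j) /\
     (forall x : nat,
        x \in A j <->
        x <= fset_max (A j) /\ fset_max (A j) - x \in A j)) /\
  ((forall j : 'I_m, odd #|` A j|) ->
   forall j : 'I_m, ~~ odd (fset_max (A j))) /\
  ((exists j : 'I_m, ~~ odd #|` A j|) ->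
   exists! j : 'I_m, odd (fset_max (A j))).
Proof.
have oddN : odd (\prod_(k < m) #|` A k|) = [forall k, odd #|` A k|].
  by rewrite (big_morph odd oddM (erefl : odd 1 = true)) big_andE.
split=> [j|].
  have eqA : A j = csub (fset_max (A j)) (A j).
    apply: fset_reflection (sum_system_dvd1 m A hA j) (sum_system_has0 m A hA j).
    exact: sum_system_gt0.
  have reflA x : x \in A j -> fset_max (A j) - x \in A j.
    by move=> xA; rewrite {2}eqA; apply/imfsetP; exists x.
  split=> // x; split=> [xA | [xM /reflA]]; last by rewrite subKn.
  by split; [apply: leq_fset_max | apply: reflA].
split=> [oddA j | [j evenA]].
  apply/negP => /(sum_system_odd_max m A hA) /negP; apply.
  by rewrite oddN; apply/forallP.
(* If all maxima were even, so would be their sum [N - 1]; but [N] is even because one cardinality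
   is. *)
have [k oddk] : exists k, odd (fset_max (A k)).
  apply/existsP; apply: contraT => /existsPn evenM.
  have : ~~ odd (\sum_(k < m) fset_max (A k)).
    by apply: (big_ind (fun n => ~~ odd n)) => // a b; rewrite oddD => /negPf->.
  have := congr1 odd (sum_system_max m A hA); rewrite /= oddN => ->.
  by move=> /forallP /(_ j); rewrite (negPf evenA).
by exists k; split=> // i; apply: sum_system_odd_max_inj.
Qed.
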